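(* Let $p$ be a prime and $a,b,c\in\mathbb{N}$ with $b>1$ such that $c\dagger p^a-1$ and $bc\dagger p^{ab}-1$. Let $R_{ab}$ and $R_a$ be any finite commutative local rings with identity whose residue fields have sizes $p^{ab}$ and $p^a$, respectively. Then both Waring numbers $g_{R_{ab}}(\frac{p^{ab}-1}{bc})$ and $g_{R_a}(\frac{p^a-1}{c})$ exist and the following hold. (a) If either $p$ is even, or else $p$ is odd and $bc$ is even, then $$g_{R_{ab}}\big(\tfrac{p^{ab}-1}{bc}\big)=b\,g_{R_a}\big(\tfrac{p^a-1}{c}\big).$$ (b) If $p$ is odd and $bc$ is odd, then $$g_{R_{ab}}\big(\tfrac{p^{ab}-1}{bc}\big)=\begin{cases} b\,g_{R_a}\big(\tfrac{p^a-1}{c}\big), & \text{if } \gamma\big(\Gamma(\tfrac{p^a-1}{c},p^a)\big)\le g(\tfrac{p^a-1}{c},p^a) \text{ or } m_a=1,\\[1mm] b\,\big(g_{R_a}\big(\tfrac{p^a-1}{c}\big)-1\big), & \text{if } \gamma\big(\Gamma(\tfrac{p^a-1}{c},p^a)\big)>g(\tfrac{p^a-1}{c},p^a) \text{ and } m_a\ge 2,\end{cases}$$ where $m_a$ is the size of the maximal ideal of $R_a$.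
   Context: For a ring $A$ and $k\in\mathbb{N}$, the Waring number $g_A(k)$ is the minimum $s\in\mathbb{N}$, if it exists, such that $x_1^k+\cdots+x_s^k=r$ has a solution in $A$ for every $r\in A$; $g(k,q)=g_{\mathbb{F}_q}(k)$. $\Gamma(k,q)$ is the directed graph with vertex set $\mathbb{F}_q$ and an arc from $v$ to $w$ iff $w-v\in\{x^k:x\in\mathbb{F}_q^*\}$. $\gamma$ of a directed graph is its girth, the length of a shortest directed cycle. For $p$ prime, $n\dagger p^m-1$ means that $n\mid p^m-1$ and $n\nmid p^j-1$ for all $1\le j<m$. *)

(* Defs.v *)
From HB Require Import structures.
From mathcomp Require Import all_boot all_order all_fingroup all_algebra.

Set Implicit Arguments.
Unset Strict Implicit.
Unset Printing Implicit Defensive.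

Import GRing.Theory.
Local Open Scope ring_scope.

Definition waring_solvable (A : pzRingType) (k s : nat) : Prop :=
  forall r : A, exists x : 'I_s -> A, \sum_(i < s) x i ^+ k = r.

(* "g_A(k) exists and equals s"; such an s is unique. *)
Definition is_waring_number (A : pzRingType) (k s : nat) : Prop :=
  waring_solvable A k s /\ forall t : nat, waring_solvable A k t -> (s <= t)%N.

(* n † p ^ m - 1 *)
Definition primitive_divisor (n p m : nat) : bool :=
  (n %| p ^ m - 1)%N && all (fun j => ~~ (n %| p ^ j - 1)%N) (iota 1 m.-1).

(* Γ(k, q) with q = #|F| *)
Definition paley_arc (F : finFieldType) (k : nat) : rel F :=
  fun v w => [exists x : F, (x != 0) && (w - v == x ^+ k)].

(* A digon v -> w -> v counts as a directed cycle of length 2. *)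
Definition directed_cycle (T : finType) (e : rel T) (c : seq T) : Prop :=
  c != [::] /\ ucycle e c.

Definition is_girth (T : finType) (e : rel T) (l : nat) : Prop :=
  (exists2 c : seq T, directed_cycle e c & size c = l) /\
  forall c : seq T, directed_cycle e c -> (l <= size c)%N.

(* [idealr_closed] includes 1 \notin I, so that it already means "proper
   ideal". *)
Definition maximal_ideal (R : finComNzRingType) (M : {set R}) : Prop :=
  idealr_closed M /\
  forall J : {set R}, idealr_closed J -> M \subset J -> J = M.

Definition local_ring_with (R : finComNzRingType) (M : {set R}) : Prop :=
  maximal_ideal M /\ forall J : {set R}, maximal_ideal J -> J = M.

(* #|R / M|, as the index of M in the group of R, whose law is addition. *)
Definition residue_card (R : finComNzRingType) (M : {set R}) : nat :=
  #|[set: R] : M|%g.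

(* Main.v *)
From HB Require Import structures.
From Stdlib Require Import Classical.
Require Import Defs.
From mathcomp Require Import all_boot all_order all_fingroup all_algebra.
From mathcomp Require Import all_solvable all_field.

Set Implicit Arguments.
Unset Strict Implicit.
Unset Printing Implicit Defensive.

Import GRing.Theory.
Local Open Scope ring_scope.

(** Let [R] be a finite local ring with maximal ideal [M] and residue field [F],
    and write [#|F| - 1 = k * c].  The nonzero [k]-th powers of [F] are its
    [c]-th roots of unity, so two numbers attached to these roots decide
    everything: [g], the least [s] such that every element of [F] is a sum of at
    most [s] roots ([roots_span]), and [v], the least length of a nonempty sum
    of roots that vanishes ([roots_vanish]).  Opening a closed walk of the
    graph into its steps shows that [v] is the girth
    ([girth_least_vanishing_sum]).  Writing [-1] as a sum of [g] roots gives
    [v <= g + 1].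

    A sum of roots of unity in [F] with at least one term lifts to a sum of
    [k]-th powers in [R] with prescribed value ([waring_lift_sum]), because [k]
    is invertible in [F].  The elements outside [M] are therefore sums of [g]
    powers.  An element of [M] is a sum of [v] powers, one of which is a unit,
    and if [1 < k] and [M] is nonzero this cannot be improved for all of [M]:
    the [k]-th powers of elements of [M] lie in an ideal strictly smaller than
    [M] ([waring_residue_vanish]).  So the Waring number of [R] is [g] when [M]
    is zero, or [k = 1], or [v <= g], and otherwise it is [v = g + 1].

    Now let [K] be an extension of [F] of degree [b], and [w] a primitive
    [(b * c)]-th root of unity in [K].  The divisibility conditions say that [w]
    has degree [b] over [F], hence [1, w, ..., w ^+ b.-1] is a basis, and since
    [w ^+ b] has order [c] the [(b * c)]-th roots of unity are the products of
    a [c]-th root of unity of [F] by one of these basis vectors.  A sum of roots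
    in [K] is thus a family of [b] independent sums of roots in [F], one for
    each coordinate.  Hence [K] has the span number [b * g] and the same
    vanishing number [v] ([extension_roots]).

    As [1 < b], the inequality [v <= g + 1 <= b * g] shows that the Waring
    number of the ring over [K] is always [b * g].  The two cases of the theorem
    only reflect whether the Waring number of the ring over [F] is [g] or
    [g + 1].  It is [g] as soon as [-1] is one of the roots of unity of [K]:
    then [v <= 2], while [1 < k] forces [2 <= g]. *)

(** * Local rings and their residue fields *)

Lemma idealr_closedP (R : finComNzRingType) (I : {set R}) :
  reflect (idealr_closed I)
    [&& 0 \in I, 1 \notin I &
        [forall a, forall u in I, forall v in I, a * u + v \in I]].
Proof.
apply: (iffP and3P) => -[I0 I1 Iadd]; split=> //.
  move=> a u v Iu Iv.
  by have /forall_inP/(_ u Iu)/forall_inP/(_ v Iv) := forallP Iadd a.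
apply/forallP=> a; apply/forall_inP=> u Iu; apply/forall_inP=> v Iv.
exact: Iadd.
Qed.

(** The principal ideal of a non-unit is proper, hence lies in some maximal
    ideal, and there is only one. *)
Lemma local_ring_unit (R : finComNzRingType) (M : {set R}) (x : R) :
  local_ring_with M -> x \notin M -> exists y, y * x = 1.
Proof.
move=> [_ uniqM] notMx; pose I := [set y * x | y : R].
have [/imsetP[y _ ->]|notI1] := boolP (1 \in I); first by exists y.
have idealI : idealr_closed I.
  split=> //; first by apply/imsetP; exists 0; rewrite ?mul0r.
  move=> a _ _ /imsetP[y _ ->] /imsetP[z _ ->].
  by apply/imsetP; exists (a * y + z); rewrite // mulrDl mulrA.
pose idealb (J : {set R}) :=
    [&& 0 \in J, 1 \notin J &
        [forall a, forall u in J, forall v in J, a * u + v \in J]].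
have idealbI : idealb I by apply/idealr_closedP.
have [J maxJ sIJ] := maxset_exists idealbI.
have [/idealr_closedP idealJ Jmax] := maxsetP maxJ.
have JM : J = M.
  apply: uniqM; split=> // J' /idealr_closedP idealJ' sJJ'.
  exact: Jmax.
case/negP: notMx; rewrite -JM (subsetP sIJ) //.
by apply/imsetP; exists 1; rewrite ?mul1r.
Qed.

Section ResidueField.

Local Open Scope quotient_scope.

Variables (R : finComNzRingType) (M : {set R}).
Hypothesis R_local : local_ring_with M.

Definition maximal_idealr : idealr R :=
  HB.pack (fun x : R => x \in M) (isIdealr.Build R _ R_local.1.1).

Local Notation Q := {ideal_quot maximal_idealr}.
Local Notation qrepr := (@generic_quotient.repr R Q).
HB.instance Definition _ := Countable.copy Q (can_type (@reprK R Q)).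
HB.instance Definition _ : isFinite Q := CanIsFinite (@reprK R Q).

Lemma quotient_eq0 (x : R) : (\pi_Q x == 0) = (x \in M).
Proof. by rewrite -(rmorph0 (\pi_Q)) -Quotient.idealrBE subr0. Qed.

Definition quotient_inv (x : Q) : Q := odflt 0 [pick y | y * x == 1].

Lemma quotient_mulVf (x : Q) : x != 0 -> quotient_inv x * x = 1.
Proof.
rewrite /quotient_inv; case: pickP => [y /eqP //|noinv].
rewrite -[x]reprK quotient_eq0 => /(local_ring_unit R_local)[y yx1].
have := noinv (\pi_Q y); rewrite -[x]reprK -[_ * _](rmorphM (\pi_Q)) yx1.
by rewrite rmorph1 eqxx.
Qed.

Lemma quotient_inv0 : quotient_inv 0 = 0.
Proof.
by rewrite /quotient_inv; case: pickP => // y; rewrite mulr0 eq_sym oner_eq0.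
Qed.

HB.instance Definition _ :=
  GRing.ComNzRing_isField.Build Q quotient_mulVf quotient_inv0.

Lemma mem_rcoset_repr (y : Q) (z : R) :
  (z \in rcoset M (qrepr y)) = (\pi_Q z == y).
Proof.
rewrite rcosetE mem_rcoset -[(_ * _)%g]/(z - qrepr y) -quotient_eq0.
by rewrite rmorphB subr_eq0 /= reprK.
Qed.

Lemma card_quotient : #|{: Q}| = residue_card M.
Proof.
rewrite /residue_card /indexg /rcosets.
have -> : rcoset M @: [set: R] = [set rcoset M (qrepr y) | y : Q].
  apply/setP=> A; apply/imsetP/imsetP=> -[x _ ->]; last by exists (qrepr x).
  exists (\pi_Q x) => //; apply/setP=> z; rewrite mem_rcoset_repr.
  rewrite rcosetE mem_rcoset -[(_ * _)%g]/(z - x) -quotient_eq0.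
  by rewrite rmorphB subr_eq0.
rewrite card_imset // => y1 y2 eq12.
have := mem_rcoset_repr y2 (qrepr y1).
by rewrite -eq12 mem_rcoset_repr reprK eqxx => /esym/eqP.
Qed.

Lemma residue_field :
  exists (F : finFieldType) (pi : {rmorphism R -> F}),
    [/\ forall y, exists x, pi x = y, forall x, (pi x == 0) = (x \in M)
      & #|F| = residue_card M].
Proof.
exists Q, (\pi_Q); split; [|exact: quotient_eq0|exact: card_quotient].
by move=> y; exists (qrepr y); apply: reprK.
Qed.

End ResidueField.

(** * Waring numbers of a local ring in terms of its residue field *)

(** Missing summands can be taken to be [0 ^+ k], so exactly [s] summands or at
    most [s] of them amount to the same. *)
Lemma waring_solvable_seqP (A : pzRingType) (k s : nat) : (0 < k)%N ->
  waring_solvable A k s <->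
  forall r : A, exists2 l : seq A, (size l <= s)%N & \sum_(x <- l) x ^+ k = r.
Proof.
move=> k_gt0; split=> solv r; have [x] := solv r.
  move=> <-; exists [seq x i | i <- enum 'I_s].
    by rewrite size_map size_enum_ord.
  by rewrite big_map enumT.
move=> le_xs <-; exists (fun i : 'I_s => nth 0 x i).
rewrite (big_nth 0) big_mkord (big_ord_widen _ (fun i => nth 0 x i ^+ k) le_xs).
rewrite [RHS]big_mkcond; apply: eq_bigr => i _ /=.
by case: ltnP => // /(nth_default 0)->; rewrite expr0n gtn_eqF.
Qed.

(** At most [s] terms rather than exactly [s]: the missing ones stand for the
    [k]-th power zero, which is not a root of unity. *)
Definition roots_span (F : nzRingType) (n s : nat) : Prop :=
  forall r : F, exists l : seq F,
    [/\ all n.-unity_root l, (size l <= s)%N & \sum_(y <- l) y = r].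

Definition roots_vanish (F : nzRingType) (n s : nat) : Prop :=
  exists l : seq F, [/\ all n.-unity_root l, l != [::], (size l <= s)%N
                      & \sum_(y <- l) y = 0].

Lemma finField_prim_root (F : finFieldType) :
  {z : F | #|F|.-1.-primitive_root z}.
Proof.
pose rs := [seq x <- enum F | x != 0].
suff /hasP/sig2W[z _ prim_z] : has #|F|.-1.-primitive_root rs by exists z.
have F_gt1 := finNzRing_gt1 F.
have rs_size : size rs = #|F|.-1.
  by rewrite /rs enumT size_filter -(cardC1 (0 : F)) cardE size_filter.
apply: has_prim_root; rewrite ?filter_uniq ?enum_uniq ?rs_size //.
- by case: #|F| F_gt1 => [|[]].
- apply/allP=> x; rewrite mem_filter unity_rootE => /andP[x_neq0 _].
  rewrite -(inj_eq (mulfI x_neq0)) -exprS prednK ?(ltnW F_gt1) //.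
  by rewrite expf_card mulr1.
- by have := enum_uniq F; rewrite enumT.
Qed.

(** The nonzero elements form a cyclic group of order [k * c], where the
    [k]-th powers and the [c]-th roots of unity are the same subgroup. *)
Lemma kth_power_unity_root (F : finFieldType) (k c : nat) (y : F) :
  #|F|.-1 = (k * c)%N ->
  reflect (exists2 x : F, x != 0 & x ^+ k = y) (c.-unity_root y).
Proof.
move=> F_card; have F_gt1 := finNzRing_gt1 F.
have kc_gt0 : (0 < k * c)%N by rewrite -F_card; case: #|F| F_gt1 => [|[]].
have [z prim_z] := finField_prim_root F; rewrite F_card in prim_z.
rewrite unity_rootE; apply: (iffP eqP) => [yc1|[x x_neq0 <-]]; last first.
  rewrite -exprM -F_card; apply: (mulfI x_neq0).
  by rewrite -exprS prednK ?(ltnW F_gt1) // expf_card mulr1.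
have [|i y_zi] := prim_rootP prim_z (x := y).
  by rewrite mulnC exprM yc1 expr1n.
have /dvdnP[j i_jk] : (k %| i)%N.
  have /andP[_ c_gt0] : (0 < k)%N && (0 < c)%N by rewrite -muln_gt0.
  by rewrite -(dvdn_pmul2r c_gt0) (prim_order_dvd prim_z) exprM -y_zi yc1.
exists (z ^+ j); last by rewrite -exprM -i_jk y_zi.
rewrite expf_neq0 //; apply: contra_eq_neq (prim_expr_order prim_z) => ->.
by rewrite expr0n gtn_eqF // eq_sym oner_neq0.
Qed.

Section LocalWaring.

Variables (R : finComNzRingType) (M : {set R}) (F : finFieldType).
Variable pi : {rmorphism R -> F}.
Hypothesis R_local : local_ring_with M.
Hypothesis pi_surj : forall y, exists x, pi x = y.
Hypothesis pi_eq0 : forall x, (pi x == 0) = (x \in M).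

Lemma residue_unit (x : R) : pi x != 0 -> exists y, y * x = 1.
Proof. by rewrite pi_eq0; apply: local_ring_unit. Qed.

(** Hensel's lemma for [y ^+ k = u], by counting: on the finite residue class
    of [x] the [k]-th power map is injective, since [y ^+ k - z ^+ k] is
    [y - z] times a sum with the nonzero residue [k * pi x ^+ k.-1]; and the
    class of [x ^+ k], where it takes its values, has as many elements. *)
Lemma kth_root_lift (k : nat) (x u : R) :
  k%:R != 0 :> F -> pi x != 0 -> pi u = pi x ^+ k -> exists y, y ^+ k = u.
Proof.
move=> k_neq0 x_unit u_xk.
pose C w := [set y | pi y == w].
have C_card z : #|C (pi z)| = #|M|.
  rewrite -(card_imset M (addIr z)); congr #|pred_of_set _|.
  apply/setP=> y; rewrite inE; apply/eqP/imsetP=> [yz|[m Mm ->]].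
    by exists (y - z); rewrite ?subrK // -pi_eq0 rmorphB yz subrr.
  by move: Mm; rewrite -pi_eq0 rmorphD => /eqP->; rewrite add0r.
have k_gt0 : (0 < k)%N by case: k k_neq0 {u_xk}; rewrite ?eqxx.
have pow_inj : {in C (pi x) &, injective (fun y => y ^+ k)}.
  move=> y z; rewrite !inE => /eqP y_x /eqP z_x /eqP.
  rewrite -subr_eq0 subrXX => /eqP yz0; apply/eqP; rewrite -subr_eq0.
  set S := (X in _ * X) in yz0.
  suff /residue_unit[S' S'S] : pi S != 0.
    by rewrite -[y - z]mulr1 -S'S mulrCA yz0 mulr0.
  rewrite rmorph_sum (eq_bigr (fun=> pi x ^+ k.-1)) => [|i _]; last first.
    by rewrite rmorphM !rmorphXn y_x z_x -exprD subnK // -ltnS prednK.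
  by rewrite sumr_const card_ord -mulr_natr mulf_neq0 ?expf_neq0.
have : u \in C (pi (x ^+ k)) by rewrite inE u_xk rmorphXn.
suff <- : [set y ^+ k | y in C (pi x)] = C (pi (x ^+ k)).
  by case/imsetP=> y _ ->; exists y.
apply/eqP; rewrite eqEcard card_in_imset // !C_card leqnn andbT.
by apply/subsetP=> _ /imsetP[y + ->]; rewrite !inE !rmorphXn => /eqP->.
Qed.

(** By finiteness [m ^+ i = m ^+ j] for some [i < j], and [1 - m ^+ (j - i)] is
    a unit. *)
Lemma maximal_nilpotent (m : R) : m \in M -> exists n, m ^+ n = 0.
Proof.
move=> Mm; have : ~~ injectiveb (fun i : 'I_#|R|.+1 => m ^+ i).
  by apply/negP=> /injectiveP/leq_card; rewrite card_ord ltnn.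
case/injectivePn=> i [j neq_ij]; wlog: i j neq_ij / (i < j)%N => [wl|lt_ij mij].
  have := neq_ij; rewrite -val_eqE neq_ltn => /orP[lt_ij|lt_ji] eq_m.
    exact: (wl i j).
  by apply: (wl j i) => //; rewrite eq_sym.
exists i; have [|y y1] := @residue_unit (1 - m ^+ (j - i)).
  have := Mm; rewrite -pi_eq0 rmorphB rmorph1 rmorphXn => /eqP->.
  by rewrite expr0n subn_eq0 leqNgt lt_ij subr0 oner_neq0.
rewrite -[LHS]mulr1 -y1 mulrCA mulrBr mulr1 -exprD subnKC ?(ltnW lt_ij) //.
by rewrite mij subrr mulr0.
Qed.

(** A nonzero [M] contains an ideal [N] with [M * M <= N < M]: take [N] maximal
    among the ideals strictly inside [M].  For [m] in [M], the ideal [m M + N]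
    is [N] or [M], and the second case would give [M = m ^+ n M + N] for all
    [n], hence [M = N] because [m] is nilpotent. *)
Lemma maximal_square_proper :
  M != [set 0] ->
  exists N : {set R}, [/\ idealr_closed N, N \proper M
                        & {in M &, forall x y, x * y \in N}].
Proof.
have [M0 M1 Madd] := R_local.1.1; move=> M_neq0.
pose P (N : {set R}) :=
  [&& 0 \in N, 1 \notin N &
      [forall a, forall u in N, forall v in N, a * u + v \in N]]
  && (N \proper M).
have P0 : P [set 0].
  apply/andP; split; last by rewrite properEneq eq_sym M_neq0 sub1set.
  apply/idealr_closedP; split; rewrite ?inE ?oner_neq0 //.
  by move=> a u v /set1P-> /set1P->; rewrite inE mulr0 addr0.
have [N maxN _] := maxset_exists P0.
have [/andP[/idealr_closedP idealN properN] Nmax] := maxsetP maxN.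
exists N; split=> // m y Mm My; have [N0 N1 Nadd] := idealN.
have sNM := subsetP (proper_sub properN).
pose J := [set m * z + n | z in M, n in N].
have inJ z n : z \in M -> n \in N -> m * z + n \in J.
  by move=> Mz Nn; apply/imset2P; exists z n.
have sNJ : N \subset J.
  by apply/subsetP=> n Nn; rewrite -[n]add0r -(mulr0 m) inJ.
have sJM : J \subset M.
  by apply/subsetP=> _ /imset2P[z n Mz Nn ->]; apply: Madd => //; apply: sNM.
have neqJM : J != M.
  apply/eqP=> JM; have [n mn0] := maximal_nilpotent Mm.
  have step i z : z \in M -> exists2 x, x \in M & z - m ^+ i * x \in N.
    elim: i => [|i IHi] Mz; first by exists z; rewrite // mul1r subrr.
    have [x Mx Nx] := IHi Mz; move: Mx; rewrite -{1}JM.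
    case/imset2P=> x' n' Mx' Nn' x_def; exists x' => //.
    have := Nadd (m ^+ i) _ _ Nn' Nx.
    rewrite x_def mulrDr opprD (addrA z) [X in X \in _]addrC subrK.
    by rewrite exprSr -mulrA.
  case/properP: properN => _ [z Mz]; case/negP.
  by have [x _] := step n z Mz; rewrite mn0 mul0r subr0.
have PJ : P J.
  apply/andP; split; last by rewrite properEneq neqJM.
  apply/idealr_closedP; split; first exact: (subsetP sNJ).
    by apply: contra M1; apply: (subsetP sJM).
  move=> a _ _ /imset2P[z n Mz Nn ->] /imset2P[z' n' Mz' Nn' ->].
  have -> : a * (m * z + n) + (m * z' + n') = m * (a * z + z') + (a * n + n').
    by rewrite !mulrDr mulrCA addrACA.
  by rewrite inJ ?Madd ?Nadd.
by rewrite -(Nmax J PJ sNJ) -[m * y]addr0 inJ.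
Qed.

Variables k c : nat.
Hypothesis F_card : #|F|.-1 = (k * c)%N.

Let powP := fun y : F => kth_power_unity_root y F_card.

Lemma cofactor_gt0 : (0 < k)%N.
Proof.
have := finNzRing_gt1 F; case: k F_card => // F1 F_gt1.
by case: #|F| F_gt1 F1 => [|[]].
Qed.

(** Only the terms outside [M] matter modulo [M]. *)
Lemma residue_power_sum (l : seq R) :
  let l' := [seq pi x ^+ k | x <- l & pi x != 0] in
  all c.-unity_root l' /\ \sum_(y <- l') y = pi (\sum_(x <- l) x ^+ k).
Proof.
split.
  apply/allP=> _ /mapP[x + ->]; rewrite mem_filter => /andP[x_neq0 _].
  by apply/powP; exists (pi x).
rewrite big_map big_filter big_mkcond rmorph_sum; apply: eq_bigr => x _ /=.
by rewrite rmorphXn; case: eqP => // ->; rewrite expr0n gtn_eqF ?cofactor_gt0.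
Qed.

Lemma waring_residue_span (s : nat) : waring_solvable R k s -> roots_span F c s.
Proof.
move/(waring_solvable_seqP _ _ cofactor_gt0)=> solv y.
have [x <-] := pi_surj y; have [l le_ls <-] := solv x.
have [rootl suml] := residue_power_sum l.
exists [seq pi x ^+ k | x <- l & pi x != 0]; split=> //.
by rewrite size_map size_filter (leq_trans (count_size _ _)).
Qed.

Hypothesis k_neq0 : k%:R != 0 :> F.

(** Lift all the terms but one arbitrarily; the lifting lemma absorbs the error
    in the remaining one. *)
Lemma waring_lift_sum (r : R) (l : seq F) :
  all c.-unity_root l -> l != [::] -> \sum_(y <- l) y = pi r ->
  exists2 xs : seq R, size xs = size l & \sum_(x <- xs) x ^+ k = r.
Proof.
have lift y : c.-unity_root y -> exists2 x, pi x != 0 & pi x ^+ k = y.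
  by case/powP=> w; have [x <-] := pi_surj w; exists x.
case: l => // y l /= /andP[/lift[x x_neq0 xy] rootl] _.
rewrite big_cons => suml.
have [xs xs_size xs_sum] : exists2 xs : seq R, size xs = size l
    & pi (\sum_(x <- xs) x ^+ k) = \sum_(y <- l) y.
  elim: l rootl {suml} => [_|z l IHl] /=.
    by exists [::]; rewrite ?big_nil ?rmorph0.
  case/andP=> /lift[w _ wz] /IHl[xs <- xs_sum]; exists (w :: xs) => //.
  by rewrite !big_cons rmorphD rmorphXn wz xs_sum.
set u := r - \sum_(x <- xs) x ^+ k.
have [|x' x'_eq] := kth_root_lift (u := u) k_neq0 x_neq0.
  by rewrite rmorphB xs_sum -suml xy addrK.
exists (x' :: xs); first by rewrite /= xs_size.
by rewrite big_cons x'_eq subrK.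
Qed.

Lemma waring_lift (s : nat) :
  roots_span F c s -> roots_vanish F c s \/ M = [set 0] ->
  waring_solvable R k s.
Proof.
move=> spanF vanF; apply/(waring_solvable_seqP _ _ cofactor_gt0) => r.
have [r0|r_neq0] := eqVneq (pi r) 0; last first.
  have [l [rootl le_ls suml]] := spanF (pi r).
  have [|xs xs_size xs_sum] := waring_lift_sum rootl _ suml.
    by apply: contraNneq r_neq0 => l0; rewrite -suml l0 big_nil.
  by exists xs; rewrite ?xs_size.
case: vanF => [[l [rootl l_neq0 le_ls suml]]|M0].
  have [|xs xs_size xs_sum] := waring_lift_sum rootl l_neq0 (r := r).
    by rewrite suml.
  by exists xs; rewrite ?xs_size.
exists [::]; rewrite // big_nil; apply/esym/set1P.
by rewrite -M0 -pi_eq0 r0.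
Qed.

(** Take [r] in [M] but not in the ideal [N] above: if only non-units occur in
    a representation of [r], all its terms are in [M * M], as [1 < k], hence in
    [N]. Some unit thus occurs, and reducing modulo [M] the terms that are units
    gives the vanishing sum. *)
Lemma waring_residue_vanish (s : nat) :
  (1 < k)%N -> M != [set 0] -> waring_solvable R k s -> roots_vanish F c s.
Proof.
move=> k_gt1 /maximal_square_proper[N [[N0 _ Nadd] + NMM]].
case/properP=> _ [r Mr notNr].
move/(waring_solvable_seqP _ _ cofactor_gt0)/(_ r)=> [l le_ls suml].
have [] := residue_power_sum l; set l' := map _ _; move=> rootl' suml'.
exists l'; split=> //.
- apply: contraNneq notNr => /(congr1 size); rewrite size_map => /eqP.
  rewrite size_filter -leqn0 leqNgt -has_count -all_predC => /allP l_M.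
  rewrite -suml big_seq; elim/big_rec: _ => // x y /l_M /=.
  rewrite negbK pi_eq0 => Mx Ny; have [_ _ Madd] := R_local.1.1.
  rewrite -(subnKC k_gt1) exprD mulrC Nadd //; exact: NMM.
- by rewrite size_map size_filter (leq_trans (count_size _ _)).
by rewrite suml' suml; apply/eqP; rewrite pi_eq0.
Qed.

End LocalWaring.

(** * Embeddings of finite fields *)

(** [#|F|] is a power of the characteristic, which [K] shares with [F]. *)
Lemma exprD_card (F K : finFieldType) (phi : {rmorphism F -> K}) (x y : K) :
  (x + y) ^+ #|F| = x ^+ #|F| + y ^+ #|F|.
Proof.
have [p p_prime pcharF] := finPcharP F.
have pcharK : p \in [pchar K] by rewrite (rmorph_pchar phi).
apply: exprDn_pchar; rewrite (eq_pnat _ (pcharf_eq pcharK)).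
by have := pprimeChar_pgroup pcharF; rewrite /pgroup cardsT.
Qed.

Section FieldEmbedding.

Variables (F K : finFieldType) (p a b : nat).
Hypothesis p_prime : prime p.
Hypothesis F_card : #|F| = (p ^ a)%N.
Hypothesis K_card : #|K| = (#|F| ^ b)%N.

(** Map a generator of [F] over the prime field to a root in [K] of its minimal
    polynomial, which splits in [K] since it divides ['X^#|K| - 'X]. *)
Lemma finField_embedding : inhabited {rmorphism F -> K}.
Proof.
have pcharF := card_finPcharP F_card p_prime.
have pcharK : p \in [pchar K].
  by apply: (@card_finPcharP _ _ (a * b)); rewrite // K_card F_card expnM.
pose FL := pPrimeCharType pcharF; pose KL := pPrimeCharType pcharK.
have [z prim_z] := finField_prim_root F.
pose evF (P : {poly 'F_p}) : F := (map_poly (in_alg FL) P).[z : FL].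
have [m minz] : exists m, minPoly 1 (z : FL) = map_poly (in_alg FL) m.
  exact/polyOver1P/minPolyOver.
have dvd_m P : evF P = 0 -> m %| P.
  move=> P0; rewrite -(dvdp_map (in_alg FL)) -minz minPoly_dvdp //.
    by apply/polyOver1P; exists P.
  by apply/eqP.
have evF0 : evF m = 0 by rewrite /evF -minz minPolyxx.
have iter_card x i : x ^+ (#|F| ^ i) = x :> F.
  by elim: i => // i IHi; rewrite expnS exprM expf_card.
have m_dvd : m %| 'X^#|K| - 'X.
  apply: dvd_m; rewrite /evF rmorphB /= map_polyXn map_polyX !hornerE.
  by rewrite K_card iter_card subrr.
have [w mw] : exists w : KL, root (map_poly (in_alg KL) m) w.
  have : map_poly (in_alg KL) m %| \prod_(x : K) ('X - x%:P).
    rewrite -finField_genPoly; move: m_dvd.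
    by rewrite -(dvdp_map (in_alg KL)) rmorphB /= map_polyXn map_polyX.
  case/dvdp_prod_XsubC=> mk; set s := mask _ _ => m_eq.
  have : size (map_poly (in_alg KL) m) != 1.
    by rewrite size_map_poly -(size_map_poly (in_alg FL)) -minz size_minPoly.
  rewrite (eqp_size m_eq).
  case: s m_eq => [|w s] m_eq; first by rewrite big_nil size_poly1.
  by exists w; rewrite (eqp_root m_eq) root_prod_XsubC mem_head.
pose evK (P : {poly 'F_p}) : K := (map_poly (in_alg KL) P).[w].
have evFB P Q : evF (P - Q) = evF P - evF Q.
  by rewrite /evF rmorphB hornerD hornerN.
have evKB P Q : evK (P - Q) = evK P - evK Q.
  by rewrite /evK rmorphB hornerD hornerN.
have evFM P Q : evF (P * Q) = evF P * evF Q by rewrite /evF rmorphM hornerM.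
have evKM P Q : evK (P * Q) = evK P * evK Q by rewrite /evK rmorphM hornerM.
(* Hence [evK] factors through the surjection [evF]. *)
have ev_eq P Q : evF P = evF Q -> evK P = evK Q.
  move/eqP; rewrite -subr_eq0 -evFB => /eqP/dvd_m/dvdpP[S PQ].
  apply/eqP; rewrite -subr_eq0 -evKB PQ evKM.
  by have /eqP := mw; rewrite -/(evK m) => ->; rewrite mulr0.
have ex_poly x : exists P, evF P == x.
  have [->|x_neq0] := eqVneq x 0.
    by exists 0; rewrite /evF rmorph0 horner0.
  have [|i ->] := prim_rootP prim_z (x := x).
    apply: (mulfI x_neq0); rewrite -exprS prednK ?expf_card ?mulr1 //.
    exact: ltnW (finNzRing_gt1 F).
  by exists 'X^i; rewrite /evF map_polyXn hornerXn.
pose phi x := evK (xchoose (ex_poly x)).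
have phiE P x : evF P = x -> phi x = evK P.
  by move=> <-; apply: ev_eq; apply/eqP/(xchooseP (ex_poly _)).
have phiP x : exists2 P, evF P = x & phi x = evK P.
  by exists (xchoose (ex_poly x)) => //; apply/eqP/(xchooseP (ex_poly x)).
have phiB : zmod_morphism phi.
  move=> x y; have [[P Px ->] [Q Qy ->]] := (phiP x, phiP y).
  by rewrite -evKB; apply: phiE; rewrite evFB Px Qy.
have phiM : monoid_morphism phi.
  split=> [|x y].
    by rewrite (phiE 1) /evK ?rmorph1 ?hornerC // /evF rmorph1 hornerC.
  have [[P Px ->] [Q Qy ->]] := (phiP x, phiP y).
  by rewrite -evKM; apply: phiE; rewrite evFM Px Qy.
pose phiA := GRing.isZmodMorphism.Build F K phi phiB.
pose phiR := GRing.isMonoidMorphism.Build F K phi phiM.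
pose phiRM : {rmorphism F -> K} := HB.pack phi phiA phiR.
exact: inhabits phiRM.
Qed.

End FieldEmbedding.

(** * Roots of unity in a power basis *)

Section PowerBasis.

Variables (F K : finFieldType) (phi : {rmorphism F -> K}) (n d : nat) (w : K).
Hypothesis d_gt0 : (0 < d)%N.
Hypothesis K_card : #|K| = (#|F| ^ d)%N.
Hypothesis prim_w : n.-primitive_root w.
Hypothesis n_dvd : (n %| #|F| ^ d - 1)%N.
Hypothesis n_ndvd : forall j, (0 < j < d)%N -> ~~ (n %| #|F| ^ j - 1)%N.

(** [n] is prime to [#|F|], so equality of the conjugates of indices [i < j]
    would make [n] divide [#|F| ^ (j - i) - 1]. *)
Lemma conjugates_inj : injective (fun i : 'I_d => w ^+ (#|F| ^ i)).
Proof.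
move=> i j; wlog: i j / (i < j)%N => [wl|lt_ij /eqP wij].
  case: (ltngtP i j) => [lt_ij|lt_ji|/val_inj //]; first exact: wl.
  by move/esym/(wl _ _ lt_ji).
have F_gt0 : (0 < #|F|)%N by apply: ltnW (finNzRing_gt1 F).
have : ~~ (n %| #|F| ^ (j - i) - 1)%N.
  by apply: n_ndvd; rewrite subn_gt0 lt_ij (leq_ltn_trans (leq_subr _ _)).
case/negP.
have cop_n : coprime n (#|F| ^ i).
  rewrite coprimeXr // -(coprime_pexpr _ _ d_gt0) (coprime_dvdl n_dvd) //.
  by rewrite subn1 coprimePn ?expn_gt0 ?F_gt0.
rewrite -(Gauss_dvdr _ cop_n) mulnBr muln1 -expnD subnKC ?(ltnW lt_ij) //.
by rewrite -eqn_mod_dvd ?leq_exp2l ?finNzRing_gt1 ?(ltnW lt_ij) //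
  -(eq_prim_root_expr prim_w) eq_sym.
Qed.

Definition power_comb (r : {ffun 'I_d -> F}) : K :=
  \sum_(i < d) phi (r i) * w ^+ i.

Lemma power_comb_conj (r : {ffun 'I_d -> F}) (i : nat) :
  \sum_(j < d) phi (r j) * (w ^+ (#|F| ^ i)) ^+ j = power_comb r ^+ (#|F| ^ i).
Proof.
elim: i => [|i IHi].
  by rewrite expn0 !expr1.
rewrite !expnSr [RHS]exprM -IHi.
rewrite (big_morph (fun x => x ^+ #|F|) (exprD_card phi) (expr0n _ _)).
rewrite gtn_eqF ?(ltnW (finNzRing_gt1 F)) //; apply: eq_bigr => j _.
by rewrite exprMn -rmorphXn expf_card -!exprM mulnAC.
Qed.

(** A relation of degree less than [d] over [F] between powers of [w] would also
    be satisfied by the [d] distinct conjugates [w ^+ (#|F| ^ i)]. *)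
Lemma power_comb_eq0 (r : {ffun 'I_d -> F}) :
  power_comb r = 0 -> forall i, r i = 0.
Proof.
move=> r0.
pose P := \poly_(j < d) (if insub j is Some i then phi (r i) else 0).
have P0 : P = 0.
  apply/eqP/negPn/negP=> P_neq0.
  have := max_poly_roots (rs := [seq w ^+ (#|F| ^ i) | i : 'I_d]) P_neq0.
  rewrite size_map -cardE card_ord (map_inj_uniq conjugates_inj) enum_uniq.
  have F_gt0 : (0 < #|F|)%N by apply: ltnW (finNzRing_gt1 F).
  rewrite ltnNge size_poly => notroots.
  suff: ~~ true by []; apply: notroots => //.
  apply/allP=> _ /mapP[i _ ->]; rewrite rootE horner_poly.
  have := power_comb_conj r i; rewrite r0 expr0n expn_eq0 gtn_eqF //= mulr0n.
  move=> root_i; apply/eqP; rewrite -[RHS]root_i.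
  by apply: eq_bigr => j _; rewrite valK.
move=> i; apply/eqP; rewrite -(fmorph_eq0 phi); apply/eqP.
have /(congr1 (fun Q : {poly K} => Q`_i)) := P0.
by rewrite coef_poly ltn_ord valK coef0.
Qed.

Lemma power_comb_bij : bijective power_comb.
Proof.
apply: inj_card_bij; last by rewrite card_ffun card_ord K_card.
move=> r1 r2 eq12; apply/ffunP=> i; apply/eqP; rewrite -subr_eq0; apply/eqP.
have := @power_comb_eq0 [ffun i => r1 i - r2 i] _ i; rewrite ffunE; apply.
rewrite -(subrr (power_comb r1)) [X in _ - X]eq12 -sumrB.
by apply: eq_bigr=> j _; rewrite ffunE rmorphB mulrBl.
Qed.

End PowerBasis.

Section PowerBasisRoots.

Variables (F K : finFieldType) (phi : {rmorphism F -> K}) (c d : nat) (w : K).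
Hypothesis d_gt0 : (0 < d)%N.
Hypothesis K_card : #|K| = (#|F| ^ d)%N.
Hypothesis prim_w : (d * c).-primitive_root w.
Hypothesis c_dvd : (c %| #|F|.-1)%N.
Hypothesis n_dvd : (d * c %| #|F| ^ d - 1)%N.
Hypothesis n_ndvd : forall j, (0 < j < d)%N -> ~~ (d * c %| #|F| ^ j - 1)%N.

Lemma power_basis_root (h : F) (i : nat) :
  c.-unity_root h -> (d * c).-unity_root (phi h * w ^+ i).
Proof.
rewrite !unity_rootE => /eqP hc; rewrite exprMn -rmorphXn mulnC exprM hc expr1n.
by rewrite rmorph1 mul1r mulnC exprAC (prim_expr_order prim_w) expr1n.
Qed.

(** The [d * c]-th roots of unity are cut by the basis [w ^+ i] into [d] scaled
    copies of the [c]-th roots of unity of [F]. *)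
Lemma power_basis_rootP (y : K) : (d * c).-unity_root y ->
  exists (i : 'I_d) (h : F), c.-unity_root h /\ y = phi h * w ^+ i.
Proof.
rewrite unity_rootE => /eqP/(prim_rootP prim_w)[j ->].
have [z prim_z] := finField_prim_root F.
have prim_zc := dvdn_prim_root prim_z c_dvd.
have : (w ^+ (j %/ d * d)) ^+ c = 1.
  by rewrite -exprM -mulnA mulnC exprM (prim_expr_order prim_w) expr1n.
rewrite -(fmorph_primitive_root phi) in prim_zc.
case/(prim_rootP prim_zc)=> i wi.
exists (Ordinal (ltn_pmod j d_gt0)), ((z ^+ (#|F|.-1 %/ c)) ^+ i); split.
  rewrite fmorph_primitive_root in prim_zc.
  by rewrite unity_rootE [_ ^+ c]exprAC (prim_expr_order prim_zc) expr1n.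
by rewrite rmorphXn -wi -exprD -divn_eq.
Qed.

Lemma unity_root_sum_split (l : seq K) : all (d * c).-unity_root l ->
  exists L : 'I_d -> seq F,
    [/\ forall i, all c.-unity_root (L i), (\sum_i size (L i) = size l)%N
      & \sum_(y <- l) y = power_comb phi w [ffun i => \sum_(h <- L i) h]].
Proof.
elim: l => [_|y l IHl].
  exists (fun=> [::]); split=> //=; first by rewrite big1.
  rewrite big_nil /power_comb big1 // => i _.
  by rewrite ffunE big_nil rmorph0 mul0r.
case/andP=> /power_basis_rootP[i [h [rooth ->]]] /IHl[L [rootL sizeL sumL]].
exists (fun j => if j == i then h :: L j else L j); split=> [j||].
- by case: ifP => _ //=; rewrite rooth rootL.
- rewrite /= -sizeL (bigD1 i) // (bigD1 (P := predT) i) //= eqxx /= addSn.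
  by congr (_ + _).+1; apply: eq_bigr => j /negPf->.
rewrite big_cons sumL /power_comb (bigD1 i) //= [RHS](bigD1 i) //=.
rewrite !ffunE eqxx big_cons rmorphD mulrDl addrA; congr (_ + _).
by apply: eq_bigr => j /negPf ji; rewrite !ffunE ji.
Qed.

Lemma unity_root_sum_merge (L : 'I_d -> seq F) :
  (forall i, all c.-unity_root (L i)) ->
  exists l : seq K,
    [/\ all (d * c).-unity_root l, (size l = \sum_i size (L i))%N
      & \sum_(y <- l) y = power_comb phi w [ffun i => \sum_(h <- L i) h]].
Proof.
move=> rootL.
exists (flatten [seq [seq phi h * w ^+ i | h <- L i] | i : 'I_d]); split.
- apply/allP=> _ /flattenP[_ /mapP[i _ ->] /mapP[h Lh ->]].
  by apply: power_basis_root; apply: (allP (rootL i)).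
- rewrite size_flatten /shape -map_comp sumnE big_map enumT.
  by apply: eq_bigr => i _; rewrite /= size_map.
rewrite big_flatten big_map enumT; apply: eq_bigr => i _.
by rewrite big_map ffunE rmorph_sum mulr_suml.
Qed.

(** Each of the [d] coordinates is a sum of at most [g] roots. *)
Lemma roots_span_lift (g : nat) :
  roots_span F c g -> roots_span K (d * c) (d * g).
Proof.
move=> spanF z.
have [f _ fK] := power_comb_bij phi d_gt0 K_card prim_w n_dvd n_ndvd.
have [L Lf] := fin_all_exists (fun i => spanF (f z i)).
have [|l [rootl sizel suml]] := @unity_root_sum_merge L.
  by move=> i; have [] := Lf i.
exists l; split=> //.
  rewrite sizel -[d in (d * g)%N]card_ord -sum_nat_const; apply: leq_sum => i _.
  by have [] := Lf i.
rewrite suml -[RHS]fK; congr (power_comb _ _ _); apply/ffunP=> i.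
by rewrite ffunE; have [] := Lf i.
Qed.

(** If [r] in [F] needs [g] roots, then the element of [K] all of whose [d]
    coordinates are [r] needs [g] roots for each of them. *)
Lemma roots_span_lift_min (g s : nat) :
  (forall t, roots_span F c t -> (g <= t)%N) -> roots_span K (d * c) s ->
  (d * g <= s)%N.
Proof.
move=> g_min spanK; case: g => [|g] in g_min *; first by rewrite muln0.
have /not_all_ex_not[r hard_r] : ~ roots_span F c g by move/g_min; rewrite ltnn.
have [l [rootl le_ls suml]] := spanK (power_comb phi w [ffun _ : 'I_d => r]).
have [L [rootL sizeL sumL]] := unity_root_sum_split rootl.
have power_comb_inj :=
  bij_inj (power_comb_bij phi d_gt0 K_card prim_w n_dvd n_ndvd).
rewrite (leq_trans _ le_ls) // -sizeL -[d in (d * _)%N]card_ord -sum_nat_const.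
apply: leq_sum => i _; rewrite ltnNge; apply/negP=> le_g; case: hard_r.
exists (L i); split=> //.
have /power_comb_inj/ffunP/(_ i) := etrans (esym sumL) suml.
by rewrite !ffunE.
Qed.

(** The coordinates of a vanishing sum vanish separately, and one of them comes
    from a nonempty sum. *)
Lemma roots_vanish_lift (s : nat) :
  roots_vanish F c s <-> roots_vanish K (d * c) s.
Proof.
split=> -[l [rootl l_neq0 le_ls suml]].
  exists [seq phi h * w ^+ 0 | h <- l]; split; rewrite ?size_map //.
  - by apply/allP=> _ /mapP[h lh ->]; apply/power_basis_root/(allP rootl).
  - by case: l l_neq0 {rootl le_ls suml}.
  by rewrite big_map -mulr_suml -rmorph_sum suml rmorph0 mul0r.
have [L [rootL sizeL sumL]] := unity_root_sum_split rootl.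
have /existsP[i L_neq0] : [exists i, L i != [::]].
  apply: contraR l_neq0 => /existsPn L0; rewrite -size_eq0 -sizeL.
  by rewrite big1 // => i _; have := L0 i; rewrite negbK => /eqP->.
exists (L i); split=> //.
  by rewrite (leq_trans _ le_ls) // -sizeL (bigD1 i) //= leq_addr.
have := power_comb_eq0 d_gt0 prim_w n_dvd n_ndvd (etrans (esym sumL) suml) i.
by rewrite ffunE.
Qed.

End PowerBasisRoots.

Lemma exists_least (P : nat -> Prop) :
  (exists n, P n) -> exists n, P n /\ forall m, P m -> (n <= m)%N.
Proof.
case=> n; elim/ltn_ind: n => n IHn Pn.
have [[m [Pm lt_mn]]|no_less] := classic (exists m, P m /\ (m < n)%N).
  exact: IHn lt_mn Pm.
exists n; split=> // m Pm; rewrite leqNgt; apply/negP=> lt_mn.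
by apply: no_less; exists m.
Qed.

(** The powers of a primitive [c]-th root form a basis of [F] over the prime
    field, whose elements are sums of ones. *)
Lemma exists_roots_span (F : finFieldType) (p a c : nat) :
  prime p -> (0 < a)%N -> #|F| = (p ^ a)%N -> primitive_divisor c p a ->
  exists s, roots_span F c s.
Proof.
move=> p_prime a_gt0 F_card /andP[c_dvd /allP c_ndvd].
have pcharF := card_finPcharP F_card p_prime.
pose FL := pPrimeCharType pcharF.
have Fp_card : #|'F_p| = p by rewrite card_Fp.
have [z prim_z] := finField_prim_root F.
have prim_w : c.-primitive_root (z ^+ (#|F|.-1 %/ c)).
  by apply: (dvdn_prim_root prim_z); rewrite F_card -subn1.
set w : FL := z ^+ _ in prim_w.
have [|||f _ fK] := @power_comb_bij 'F_p FL (in_alg FL) c a w a_gt0 _ prim_w.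
- by rewrite Fp_card -F_card.
- by rewrite Fp_card.
- move=> j /andP[j_gt0 lt_ja].
  by rewrite Fp_card c_ndvd // mem_iota j_gt0 add1n prednK.
exists (a * p)%N => r.
exists (flatten [seq nseq (f r i) (w ^+ i) | i : 'I_a]); split.
- apply/allP=> _ /flattenP[_ /mapP[i _ ->] /nseqP[-> _]].
  by rewrite unity_rootE [_ ^+ c]exprAC (prim_expr_order prim_w) expr1n.
- rewrite size_flatten /shape -map_comp sumnE big_map enumT.
  rewrite -[a in (a * p)%N]card_ord -sum_nat_const; apply: leq_sum => i _.
  by rewrite /= size_nseq ltnW // -[p in (_ < p)%N]Fp_cast.
rewrite big_flatten big_map enumT -[RHS]fK; apply: eq_bigr => i _.
(* The prime field acts on [F] through multiplication by natural numbers. *)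
rewrite -[RHS]/((f r i : nat)%:R * 1 * w ^+ i) mulr1 mulr_natl.
by rewrite big_nseq iter_addr_0.
Qed.

(** * Girth and Waring numbers *)

Lemma path_pairmapB (V : zmodType) (H : pred V) (e : rel V) (x : V)
    (s : seq V) :
  (forall v w, e v w = H (w - v)) ->
  path e x s = all H (pairmap (fun v w => w - v) x s).
Proof. by move=> eH; elim: s x => //= y s IHs x; rewrite eH IHs. Qed.

Lemma sum_pairmapB (V : zmodType) (x : V) (s : seq V) :
  \sum_(y <- pairmap (fun v w => w - v) x s) y = last x s - x.
Proof.
elim: s x => [|y s IHs] x /=; first by rewrite big_nil subrr.
by rewrite big_cons IHs addrC addrA subrK.
Qed.

(** The steps of a closed walk form a vanishing sum; conversely the partial sums
    of a vanishing sum of least length are distinct, as a repetition would cut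
    out a shorter vanishing sum. *)
Lemma girth_least_vanishing_sum (F : finFieldType) (k c g : nat) :
  #|F|.-1 = (k * c)%N -> roots_vanish F c g ->
  (forall t, roots_vanish F c t -> (g <= t)%N) -> is_girth (@paley_arc F k) g.
Proof.
move=> F_card [l [rootl l_neq0 le_lg suml]] g_min.
have arcE (v w : F) : paley_arc k v w = c.-unity_root (w - v).
  have powP := kth_power_unity_root (w - v) F_card.
  apply/existsP/powP => [[x /andP[x_neq0 /eqP wv]]|[x x_neq0 xk]].
    by exists x.
  by exists x; rewrite x_neq0 xk eqxx.
have stepE x := path_pairmapB x _ arcE.
split=> [|cyc [cyc_neq0 /andP[]]]; last first.
  rewrite (cycle_path 0) stepE => root_steps _; apply: g_min.
  exists (pairmap (fun v w => w - v) (last 0 cyc) cyc); split=> //.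
  - by rewrite -size_eq0 size_pairmap size_eq0.
  - by rewrite size_pairmap.
  by rewrite sum_pairmapB; case: (cyc) cyc_neq0 => //= x s _; rewrite subrr.
have foldE s : foldl +%R 0 s = \sum_(y <- s) y :> F.
  elim/last_ind: s => [|s y IHs]; first by rewrite big_nil.
  by rewrite -cats1 foldl_cat IHs big_cat big_seq1.
have stepK : pairmap (fun v w => w - v) 0 (scanl +%R 0 l) = l.
  by apply: (scanlK (g := +%R)) => v w; rewrite addrC addKr.
have size_l : size l = g.
  by apply/eqP; rewrite eqn_leq le_lg g_min //; exists l.
exists (scanl +%R 0 l); last by rewrite size_scanl.
split; first by rewrite -size_eq0 size_scanl size_eq0.
apply/andP; split.
  rewrite (cycle_path 0) stepE.
  have := sum_pairmapB 0 (scanl +%R 0 l); rewrite stepK suml subr0 => <-.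
  by rewrite stepK.
(* The terms between two equal partial sums, of ranks [i] and [j], cancel. *)
apply/negPn/negP => /(uniqPn 0)[i [j [lt_ij]]]; rewrite size_scanl => lt_jl.
rewrite !nth_scanl ?(ltn_trans lt_ij) // !foldE.
rewrite -[take j.+1 l](cat_take_drop i.+1) take_takel ?ltnS ?(ltnW lt_ij) //.
rewrite big_cat /= -[X in X = _]addr0 => /addrI/esym sum0.
have /g_min : roots_vanish F c (j - i).
  exists (drop i.+1 (take j.+1 l)); split=> //.
  - by apply/allP=> y /mem_drop/mem_take; apply/allP.
  - by rewrite -size_eq0 size_drop size_takel // subSS -lt0n subn_gt0.
  by rewrite size_drop size_takel // subSS.
by rewrite leqNgt -size_l (leq_ltn_trans (leq_subr _ _)).
Qed.

(** A field is its own residue field, so the results on local rings cover it. *)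
Lemma field_local_ring (F : finFieldType) : local_ring_with [set 0 : F].
Proof.
have ideal0 (J : {set F}) : idealr_closed J -> J = [set 0].
  case=> J0 J1 Jadd; apply/setP=> x; rewrite inE; apply/idP/eqP=> [Jx|-> //].
  apply: contraNeq J1 => x_neq0.
  by rewrite -(mulVf x_neq0) -[_ * x]addr0 Jadd.
have closed0 : idealr_closed [set 0 : F].
  split; rewrite ?inE ?oner_neq0 //.
  by move=> r u v /set1P-> /set1P->; rewrite inE mulr0 addr0.
split; first by split=> // J idealJ _; apply: ideal0.
by move=> J [idealJ _]; apply: ideal0.
Qed.

Lemma roots_vanish_leq (F : nzRingType) (n s t : nat) :
  (s <= t)%N -> roots_vanish F n s -> roots_vanish F n t.
Proof.
move=> le_st [l [rootl l0 le_ls suml]]; exists l; split=> //.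
exact: leq_trans le_st.
Qed.

Lemma roots_vanish_opp1 (F : nzRingType) (n : nat) :
  (-1) ^+ n = 1 :> F -> roots_vanish F n 2.
Proof.
move=> N1n; exists [:: 1; -1]; split=> //.
  by rewrite /= !unity_rootE expr1n N1n eqxx.
by rewrite big_cons big_seq1 subrr.
Qed.

(** Write [-1] as a sum of roots and add the root [1]. *)
Lemma roots_span_vanish (F : nzRingType) (n s : nat) :
  roots_span F n s -> roots_vanish F n s.+1.
Proof.
move=> /(_ (-1))[l [rootl le_ls suml]]; exists (1 :: l); split=> //.
  by rewrite /= unity_rootE expr1n eqxx.
by rewrite big_cons suml subrr.
Qed.

Lemma roots_span_gt0 (F : nzRingType) (n s : nat) :
  roots_span F n s -> (0 < s)%N.
Proof.
move=> /(_ 1)[[|y l] [_]] //=; last by case: s.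
by rewrite big_nil => _ /eqP; rewrite eq_sym oner_eq0.
Qed.

(** If single roots were enough, every nonzero element would be a [c]-th root of
    unity, but there are at most [c < k * c] of these. *)
Lemma roots_span_gt1 (F : finFieldType) (k c s : nat) :
  #|F|.-1 = (k * c)%N -> (1 < k)%N -> roots_span F c s -> (1 < s)%N.
Proof.
move=> F_card k_gt1 spanF; rewrite ltnNge; apply/negP=> s_le1.
have c_gt0 : (0 < c)%N.
  have := finNzRing_gt1 F; case: c F_card {spanF} => //; rewrite muln0.
  by case: #|F| => [|[]].
have := max_unity_roots c_gt0 (rs := enum (predC1 (0 : F))).
rewrite -cardE cardC1 F_card enum_uniq leqNgt ltn_Pmull //.
move=> few; suff: ~~ true by []; apply: few => //.
apply/allP=> y; rewrite mem_enum inE => y_neq0.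
have [l [rootl le_ls suml]] := spanF y; have := leq_trans le_ls s_le1.
case: l rootl suml {le_ls} => [|x []] //=.
  by rewrite big_nil => _ /esym/eqP; rewrite (negPf y_neq0).
by rewrite big_seq1 andbT => + <-.
Qed.

Section Residue.

Variables (R : finComNzRingType) (M : {set R}) (F : finFieldType).
Variables (pi : {rmorphism R -> F}) (p a c k : nat).
Hypothesis R_local : local_ring_with M.
Hypothesis pi_surj : forall y, exists x, pi x = y.
Hypothesis pi_eq0 : forall x, (pi x == 0) = (x \in M).
Hypothesis p_prime : prime p.
Hypothesis F_pcard : #|F| = (p ^ a)%N.
Hypothesis F_card : #|F|.-1 = (k * c)%N.

(** [k] divides [p ^ a - 1], hence is prime to the characteristic. *)
Lemma cofactor_residue_neq0 : k%:R != 0 :> F.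
Proof.
have pcharF := card_finPcharP F_pcard p_prime.
rewrite -(dvdn_pcharf pcharF); apply/negP=> p_dvd_k.
have F_gt1 := finNzRing_gt1 F.
have p_dvd_F : (p %| #|F|)%N.
  by rewrite F_pcard dvdn_exp //; case: a F_pcard F_gt1 => // ->.
have := p_dvd_F; rewrite -(prednK (ltnW F_gt1)) F_card -addn1.
rewrite dvdn_addr ?dvdn_mulr // dvdn1 => /eqP p1.
by have := p_prime; rewrite p1.
Qed.

(** An element of [M] needs no more than [g] powers: it is the empty sum if [M]
    is zero, a first power if [k = 1], and the lift of a vanishing sum in the
    third case. *)
Lemma waring_number_short_vanish (g : nat) :
  roots_span F c g -> (forall s, roots_span F c s -> (g <= s)%N) ->
  M = [set 0] \/ k = 1%N \/ roots_vanish F c g -> is_waring_number R k g.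
Proof.
move=> spanF g_min short.
have lift :=
  @waring_lift _ _ _ _ R_local pi_surj pi_eq0 _ _ F_card cofactor_residue_neq0.
split; last first.
  by move=> t /(waring_residue_span pi_surj F_card)/g_min.
case: short => [M0|[k1|vanF]]; last 2 first.
- rewrite k1; apply/waring_solvable_seqP => // r; exists [:: r].
    exact: roots_span_gt0 spanF.
  by rewrite big_seq1.
- by apply: lift => //; left.
by apply: lift => //; right.
Qed.

(** Here an element of [M] forces a vanishing sum, so both numbers count. *)
Lemma waring_number_long_vanish (g v : nat) :
  (1 < k)%N -> M != [set 0] ->
  roots_span F c g -> (forall s, roots_span F c s -> (g <= s)%N) ->
  roots_vanish F c v -> (forall s, roots_vanish F c s -> (v <= s)%N) ->
  is_waring_number R k (maxn g v).
Proof.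
move=> k_gt1 M_neq0 spanF g_min vanF v_min; split; last first.
  move=> t solv; rewrite geq_max g_min ?v_min //.
    exact: (waring_residue_vanish R_local pi_eq0 F_card k_gt1 M_neq0).
  exact: (waring_residue_span pi_surj F_card).
apply: (waring_lift R_local pi_surj pi_eq0 F_card cofactor_residue_neq0).
  move=> r; have [l [rootl le_l suml]] := spanF r.
  by exists l; split=> //; rewrite leq_max le_l.
by left; apply: roots_vanish_leq vanF; apply: leq_maxr.
Qed.

End Residue.

Section DegreeExtension.

Variables (p a b c : nat).
Hypotheses (p_prime : prime p) (a_gt0 : (0 < a)%N) (b_gt1 : (1 < b)%N).
Hypotheses (c_dagger : primitive_divisor c p a).
Hypotheses (bc_dagger : primitive_divisor (b * c)%N p (a * b)%N).

Lemma extension_roots (F K : finFieldType) :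
  #|F| = (p ^ a)%N -> #|K| = (p ^ (a * b))%N ->
  [/\ forall g, roots_span F c g -> roots_span K (b * c) (b * g),
      forall g s, (forall t, roots_span F c t -> (g <= t)%N) ->
        roots_span K (b * c) s -> (b * g <= s)%N
    & forall s, roots_vanish F c s <-> roots_vanish K (b * c) s].
Proof.
move=> F_card K_card; have b_gt0 := ltnW b_gt1.
have KF_card : #|K| = (#|F| ^ b)%N by rewrite K_card F_card expnM.
have [phi] := finField_embedding p_prime F_card KF_card.
have /andP[c_dvd _] := c_dagger; have /andP[n_dvd /allP n_ndvd] := bc_dagger.
have [z prim_z] := finField_prim_root K.
have {prim_z z} [w prim_w] : exists w : K, (b * c).-primitive_root w.
  exists (z ^+ (#|K|.-1 %/ (b * c))).
  by apply: (dvdn_prim_root prim_z); rewrite K_card -subn1.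
have c_dvdF : (c %| #|F|.-1)%N by rewrite F_card -subn1.
have n_dvdF : (b * c %| #|F| ^ b - 1)%N by rewrite F_card -expnM.
have n_ndvdF j : (0 < j < b)%N -> ~~ (b * c %| #|F| ^ j - 1)%N.
  case/andP=> j_gt0 lt_jb;
    rewrite F_card -expnM n_ndvd // mem_iota muln_gt0 a_gt0 j_gt0.
  by rewrite add1n prednK ?muln_gt0 ?a_gt0 // ltn_pmul2l.
split.
- exact: (roots_span_lift phi b_gt0 KF_card prim_w n_dvdF n_ndvdF).
- exact: (roots_span_lift_min phi b_gt0 KF_card prim_w c_dvdF n_dvdF n_ndvdF).
exact: (roots_vanish_lift phi b_gt0 prim_w c_dvdF n_dvdF n_ndvdF).
Qed.

End DegreeExtension.

Theorem theorem5p2 (p a b c : nat)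
    (p_prime : prime p) (a_gt0 : (0 < a)%N) (b_gt1 : (1 < b)%N)
    (c_gt0 : (0 < c)%N)
    (c_dagger : primitive_divisor c p a)
    (bc_dagger : primitive_divisor (b * c)%N p (a * b)%N)
    (Rab Ra : finComNzRingType) (Mab : {set Rab}) (Ma : {set Ra})
    (Rab_local : local_ring_with Mab) (Ra_local : local_ring_with Ma)
    (Rab_residue : residue_card Mab = (p ^ (a * b))%N)
    (Ra_residue : residue_card Ma = (p ^ a)%N) :
  let kab := ((p ^ (a * b) - 1) %/ (b * c))%N in
  let ka := ((p ^ a - 1) %/ c)%N in
  exists gab ga : nat,
    [/\ is_waring_number Rab kab gab,
        is_waring_number Ra ka ga,
        (~~ odd p \/ (odd p /\ ~~ odd (b * c)%N) -> gab = (b * ga)%N)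
      & (odd p -> odd (b * c)%N ->
         forall F : finFieldType, #|F| = (p ^ a)%N ->
         exists gF girth : nat,
           [/\ is_waring_number F ka gF,
               is_girth (@paley_arc F ka) girth,
               ((girth <= gF)%N \/ #|Ma| = 1%N -> gab = (b * ga)%N)
             & ((gF < girth)%N /\ (2 <= #|Ma|)%N ->
                gab = (b * (ga - 1))%N)])].
Proof.
move=> kab ka; have b_gt0 := ltnW b_gt1.
have [K [piK [piK_surj piK_eq0 K_card]]] := residue_field Rab_local.
have [E [piE [piE_surj piE_eq0 E_card]]] := residue_field Ra_local.
rewrite Rab_residue in K_card; rewrite Ra_residue in E_card.
have K_kab : #|K|.-1 = (kab * (b * c))%N.
  by rewrite K_card -subn1 divnK //; case/andP: bc_dagger.
have card_ka (F : finFieldType) : #|F| = (p ^ a)%N -> #|F|.-1 = (ka * c)%N.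
  by move=> ->; rewrite -subn1 divnK //; case/andP: c_dagger.
have ext (F : finFieldType) (F_card : #|F| = (p ^ a)%N) :=
  extension_roots p_prime a_gt0 b_gt1 c_dagger bc_dagger F_card K_card.
have ex_span (F : finFieldType) (F_card : #|F| = (p ^ a)%N) :=
  exists_least (exists_roots_span p_prime a_gt0 F_card c_dagger).
have [spanEK spanEK_min vanEK] := ext E E_card.
have [g [spanE g_min]] := ex_span E E_card.
have g_gt0 := roots_span_gt0 spanE.
have [v [vanE v_min]] : exists v, roots_vanish E c v /\
    forall s, roots_vanish E c s -> (v <= s)%N.
  by apply: exists_least; exists g.+1; apply: roots_span_vanish.
have le_vg : (v <= g.+1)%N by apply: v_min; apply: roots_span_vanish.
have waring_ab : is_waring_number Rab kab (b * g).
  apply: (waring_number_short_vanish Rab_local piK_surj piK_eq0 p_prime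
    K_card K_kab).
  - exact: spanEK.
  - by move=> s; apply: spanEK_min.
  right; right; apply/vanEK; apply: roots_vanish_leq vanE.
  apply: leq_trans le_vg _.
  rewrite (leq_trans _ (leq_mul b_gt1 (leqnn g))) //.
  by rewrite mul2n -addnn -addn1 leq_add2l.
have ka_gt0 := cofactor_gt0 (card_ka E E_card).
have [ga [waring_a ga_short ga_long]] : exists ga, [/\
    is_waring_number Ra ka ga,
    Ma = [set 0] \/ ka = 1%N \/ roots_vanish E c g -> ga = g
  & Ma != [set 0] -> (1 < ka)%N -> ga = maxn g v].
  have waring_short := waring_number_short_vanish Ra_local piE_surj piE_eq0
    p_prime E_card (card_ka E E_card) spanE g_min.
  have [Ma0|Ma_neq0] := eqVneq Ma [set 0].
    by exists g; split=> //; apply: waring_short; left.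
  have [ka_gt1|ka_le1] := ltnP 1 ka; last first.
    have ka1 : ka = 1%N by apply/eqP; rewrite eqn_leq ka_le1.
    by exists g; split=> //; apply: waring_short; right; left.
  exists (maxn g v); split=> //.
    exact: (waring_number_long_vanish Ra_local piE_surj piE_eq0 p_prime E_card
      (card_ka E E_card)).
  case=> [/eqP|[ka1|/v_min]]; first by rewrite (negPf Ma_neq0).
    by rewrite ka1 in ka_gt1.
  by move/maxn_idPl.
exists (b * g)%N, ga; split=> //.
  move=> even_case; rewrite ga_short //; right.
  (* It remains to see that [v <= 2 <= g] if [1 < ka]. *)
  have [ka_gt1|ka_le1] := ltnP 1 ka; last first.
    by left; apply/eqP; rewrite eqn_leq ka_le1.
  right; apply: (@roots_vanish_leq _ _ 2).
    exact: roots_span_gt1 (card_ka E E_card) ka_gt1 spanE.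
  case: even_case => [p_even|[_ bc_even]]; last first.
    by apply/vanEK/roots_vanish_opp1; rewrite -signr_odd (negPf bc_even).
  have p2 : p = 2.
    by case: (even_prime p_prime) => // p_odd; rewrite p_odd in p_even.
  have := card_finPcharP E_card p_prime; rewrite p2 => pcharE.
  by apply: roots_vanish_opp1; rewrite oppr_pchar2 // expr1n.
move=> p_odd bc_odd F F_card; exists g, v.
have [spanFK spanFK_min vanFK] := ext F F_card.
(* [F] and the residue field of [Ra] have the same numbers, as both determine
   those of [K]. *)
have [gF [spanF gF_min]] := ex_span F F_card.
have gFg : gF = g.
  apply/eqP; rewrite -(eqn_pmul2l b_gt0) eqn_leq.
  rewrite (spanFK_min _ _ gF_min (spanEK _ spanE)).
  by rewrite (spanEK_min _ _ g_min (spanFK _ spanF)).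
rewrite gFg in spanF gF_min.
have vanEF s : roots_vanish E c s <-> roots_vanish F c s.
  by split=> [/vanEK/vanFK|/vanFK/vanEK].
have Ma_0 : 0 \in Ma by case: Ra_local => -[[]].
split.
- apply: (@waring_number_short_vanish _ [set 0] F idfun p a c) => //.
  + exact: field_local_ring.
  + by move=> y; exists y.
  + by move=> x; rewrite inE.
  + exact: card_ka.
  by left.
- apply: (girth_least_vanishing_sum (card_ka F F_card)); first exact/vanEF.
  by move=> t /vanEF/v_min.
- move=> short; rewrite ga_short //.
  case: short => [le_vg'|/eqP/cards1P[x Max]]; last first.
    by left; move: Ma_0; rewrite Max => /set1P->.
  by right; right; apply: roots_vanish_leq vanE.
case=> lt_gv Ma_gt1; rewrite ga_long.
- have -> : v = g.+1 by apply/eqP; rewrite eqn_leq le_vg.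
  by rewrite (maxn_idPr (leqnSn g)) subn1.
- by apply: contraTneq Ma_gt1 => ->; rewrite cards1.
(* If [ka = 1] then [c = p ^ a - 1], which is even. *)
rewrite ltn_neqAle eq_sym ka_gt0 andbT; apply/eqP=> ka1.
have := card_ka E E_card; rewrite ka1 mul1n E_card => /(congr1 odd).
move: bc_odd; rewrite oddM => /andP[_ ->].
by rewrite -subn1 oddB ?expn_gt0 ?prime_gt0 // oddX p_odd orbT.
Qed.
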